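(* Fix constants $\lambda_1,\ldots,\lambda_K\ge 0$ and $\Gamma^{\rm ST}_1,\ldots,\Gamma^{\rm ST}_M>0$. For a channel realization $\boldsymbol{\alpha}$ consider the problem $$\max_{p_1,\ldots,p_K}\ \log\Big(1+\sum_{k=1}^K h_kp_k\Big)-\sum_{k=1}^K\lambda_kp_k\quad\text{s.t.}\quad \sum_{k=1}^K g_{km}p_k\le\Gamma_m^{\rm ST}\ \ \forall m,\qquad p_k\ge 0\ \ \forall k.$$ For almost every realization $\boldsymbol{\alpha}$: this problem has an optimal solution in which at most one user (user $i$) has positive power and all other users have zero power if and only if there is a user $i$ which, with $m'=\arg\min_{m\in\{1,\ldots,M\}}\Gamma_m^{\rm ST}/g_{im}$, satisfies one of the following two sets of conditions: (a) $\frac{1}{\lambda_i}-\frac{1}{h_i}\le\frac{\Gamma_{m'}^{\rm ST}}{g_{im'}}$ and $\frac{h_i}{\lambda_i}\ge\frac{h_j}{\lambda_j}$ for all $j\ne i$; in this case the optimal power of user $i$ is $p_i^*=\big(\frac{1}{\lambda_i}-\frac{1}{h_i}\big)^+$; (b) $\frac{1}{\lambda_i}-\frac{1}{h_i}>\frac{\Gamma_{m'}^{\rm ST}}{g_{im'}}$ and $\left(h_jg_{im'}-h_ig_{jm'}\right)\frac{g_{im'}}{g_{im'}+h_i\Gamma_{m'}^{\rm ST}}\le \lambda_jg_{im'}-\lambda_ig_{jm'}$ for all $j\neq i$; in this case $p_i^*=\frac{\Gamma_{m'}^{\rm ST}}{g_{im'}}$.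
   Context: $\boldsymbol{\alpha}=(h_1,\ldots,h_K,g_{11},\ldots,g_{KM})$ is a random vector of nonnegative channel power gains ($h_k$: secondary user $k$ to secondary base station; $g_{km}$: secondary user $k$ to primary receiver $m$) with a continuous, differentiable joint cumulative distribution function, the $h_k$'s and $g_{km}$'s being independent. This per-fading-state problem arises (with $\lambda_k$ the Lagrange multipliers of long-term transmit-power constraints) in maximizing the ergodic sum rate of the fading cognitive multiple-access channel under long-term transmit-power and short-term interference-power constraints. Convention: $1/0=+\infty$ and $x/0=+\infty$ for $x>0$. $(x)^+=\max(0,x)$. *)

(* Defs.v *)
From HB Require Import structures.
From mathcomp Require Import all_boot all_order all_algebra.
From mathcomp Require Import all_classical all_reals all_analysis.
Set Implicit Arguments. Unset Strict Implicit. Unset Printing Implicit Defensive.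
Import Order.TTheory GRing.Theory Num.Theory.
Import numFieldNormedType.Exports.
Local Open Scope classical_set_scope.
Local Open Scope ring_scope.

(* Division into the extended reals with the paper's convention x/0 = +oo
   (used for 1/lambda, 1/h, h/lambda, Gamma/g). *)
Definition erdiv (R : realType) (x y : R) : \bar R :=
  if y == 0 then +oo%E else (x / y)%:E.

Section Channel.
Context {R : realType} {d : measure_display} {Omega : measurableType d}.

(* Mutual independence of a finite family of real random variables:
   the product rule for every choice of Borel sets (taking B i = setT
   recovers every subfamily). *)
Definition mutually_independent (P : probability Omega R) (I : finType)
    (X : I -> Omega -> R) : Prop :=
  forall B : I -> set R, (forall i, measurable (B i)) ->
    fine (P (\bigcap_(i in setT) (X i @^-1` B i))) =
    \prod_(i : I) fine (P (X i @^-1` B i)).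

Definition joint_cdf (P : probability Omega R) (N : nat)
    (alpha : Omega -> 'rV[R]_N) (x : 'rV[R]_N) : R :=
  fine (P [set w | forall j, alpha w 0 j <= x 0 j]).
End Channel.

(* The channel vector alpha is stored as a row vector of length K + K*M:
   the first K entries are h_1..h_K, the remaining ones are g_{km}. *)
Definition hgain (R : realType) (K M : nat) (a : 'rV[R]_(K + K * M))
  (k : 'I_K) : R := a 0 (lshift (K * M) k).
Definition ggain (R : realType) (K M : nat) (a : 'rV[R]_(K + K * M))
  (k : 'I_K) (m : 'I_M) : R := a 0 (rshift K (mxvec_index k m)).

Section Problem.
Context {R : realType} {K M : nat}.
Variables (lam : 'I_K -> R) (Gam : 'I_M -> R)
  (h : 'I_K -> R) (g : 'I_K -> 'I_M -> R).

Definition objective (p : 'I_K -> R) : R :=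
  ln (1 + \sum_(k < K) h k * p k) - \sum_(k < K) lam k * p k.

Definition feasible (p : 'I_K -> R) : Prop :=
  (forall k, 0 <= p k) /\ (forall m, \sum_(k < K) g k m * p k <= Gam m).

Definition optimal (p : 'I_K -> R) : Prop :=
  feasible p /\ forall q, feasible q -> objective q <= objective p.

Definition single_user (i : 'I_K) (t : R) : 'I_K -> R :=
  fun k => if k == i then t else 0.

Definition is_argmin_ratio (i : 'I_K) (m' : 'I_M) : Prop :=
  forall m, (erdiv (Gam m') (g i m') <= erdiv (Gam m) (g i m))%E.

Definition cond_a (i : 'I_K) (m' : 'I_M) : Prop :=
  (erdiv 1 (lam i) - erdiv 1 (h i) <= erdiv (Gam m') (g i m'))%E /\
  forall j, j != i -> (erdiv (h j) (lam j) <= erdiv (h i) (lam i))%E.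

Definition cond_b (i : 'I_K) (m' : 'I_M) : Prop :=
  (erdiv (Gam m') (g i m') < erdiv 1 (lam i) - erdiv 1 (h i))%E /\
  forall j, j != i ->
    (h j * g i m' - h i * g j m') * (g i m' / (g i m' + h i * Gam m'))
      <= lam j * g i m' - lam i * g j m'.

Definition pstar_a (i : 'I_K) : R := Num.max 0 ((lam i)^-1 - (h i)^-1).
Definition pstar_b (i : 'I_K) (m' : 'I_M) : R := Gam m' / g i m'.
End Problem.

(* Main.v *)
(** Off a null set all channel gains are positive and, for each user [i], the
ratios [Gam m / g i m] are pairwise distinct: a continuous joint CDF has
atomless marginals, and by independence and Fubini a relation
[a X = b Y] with [b <> 0] then has probability zero.

For such a realization the objective is concave and the constraints are
linear, so optimality amounts to the KKT conditions, here obtained from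
[ln x <= x - 1].  A single-user optimum [t] either is zero, or leaves all
interference constraints slack (multiplier zero, condition (a)), or meets
exactly one of them, the one indexed by the argmin.  In the last case, trading
power of user [i] for power of user [j] along this constraint gives the
inequality of (b), which degenerates to the one of (a) when the multiplier
vanishes. *)

Require Import Defs.
From HB Require Import structures.
From mathcomp Require Import all_boot all_order all_algebra.
From mathcomp Require Import all_classical all_reals all_analysis.
From mathcomp Require Import measurable_realfun.
From mathcomp Require Import ring lra.
Import Order.TTheory GRing.Theory Num.Theory.
Import numFieldNormedType.Exports.
Local Open Scope classical_set_scope.
Local Open Scope ring_scope.

(** * Elementary estimates *)

(** The tangent line of [ln] at [s]; concavity of the objective enters only through this bound. *)
Lemma lnB_le (R : realType) (x s : R) : 0 < x -> 0 < s ->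
  ln x - ln s <= x / s - 1.
Proof.
move=> x0 s0; rewrite -ln_div//.
have xs0 : 0 < x / s by exact: divr_gt0.
have -> : ln (x / s) = ln (1 + (x / s - 1)) by congr ln; lra.
by apply: le_ln1Dx; lra.
Qed.

Lemma near0_addM_gt0 (R : realType) (x y : R) : 0 < x ->
  \forall e \near 0^'+, 0 < x + e * y.
Proof.
move=> x0; have [y0|y0] := lerP 0 y; near=> e.
  by rewrite ltr_wpDr// mulr_ge0// ltW//; near: e; exact: nbhs_right_gt.
rewrite -[y]opprK mulrN subr_gt0 -ltr_pdivlMr ?oppr_gt0//; near: e.
by apply: nbhs_right_lt; rewrite divr_gt0 ?oppr_gt0.
Unshelve. all: by end_near. Qed.

(** Survival of one linear constraint under a small step: either it is slack, or the direction does
    not push against it. *)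
Lemma near0_addM_ge0 (R : realType) (x y : R) : 0 <= x -> 0 < x \/ 0 <= y ->
  \forall e \near 0^'+, 0 <= x + e * y.
Proof.
move=> x0 [{}x0|y0]; near=> e.
  by apply: ltW; near: e; exact: near0_addM_gt0.
by rewrite addr_ge0// mulr_ge0// ltW//; near: e; exact: nbhs_right_gt.
Unshelve. all: by end_near. Qed.

Lemma sum_single_user (R : realType) (K : nat) (f : 'I_K -> R) i t :
  \sum_(k < K) f k * single_user i t k = f i * t.
Proof.
rewrite (bigD1 i)//= big1 ?addr0 => [|k /negbTE ki]; rewrite /single_user ?eqxx//.
by rewrite ki mulr0.
Qed.

Lemma erdivE (R : realType) (x y : R) : y != 0 -> erdiv x y = (x / y)%:E.
Proof. by rewrite /erdiv => /negbTE ->. Qed.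

(** * KKT conditions for a fixed realization with positive gains *)

Section Deterministic.
Context (R : realType) (K M : nat).
Context (lam : 'I_K -> R) (Gam : 'I_M -> R).
Context (h : 'I_K -> R) (g : 'I_K -> 'I_M -> R).
Hypothesis lam0 : forall k, 0 <= lam k.
Hypothesis Gam0 : forall m, 0 < Gam m.
Hypothesis h0 : forall k, 0 < h k.
Hypothesis g0 : forall k m, 0 < g k m.

(** The objective has partial derivatives [h k / gain p - lam k]; first-order conditions are stated
    below multiplied by this positive factor. *)
Let gain (p : 'I_K -> R) := 1 + \sum_(k < K) h k * p k.

Let gain_gt0 p : (forall k, 0 <= p k) -> 0 < gain p.
Proof.
move=> p0; rewrite ltr_pwDl// sumr_ge0// => k _.
by rewrite mulr_ge0// ltW.
Qed.

(** A single multiplier suffices for the candidates below: it is zero in (a) and sits on the argmin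
    constraint in (b). Stationarity, weighted by the powers and summed, bounds the tangent line of
    the logarithm at [gain p]. *)
Lemma kkt_optimal p m mu : feasible Gam g p -> 0 <= mu ->
  mu * (\sum_(k < K) g k m * p k) = mu * Gam m ->
  (forall k, h k <= gain p * (lam k + mu * g k m)) ->
  (forall k, p k = 0 \/ h k = gain p * (lam k + mu * g k m)) ->
  optimal lam Gam h g p.
Proof.
move=> fp mu0 slack hle heq; split=> // q [q0 qG].
have s0 := gain_gt0 p fp.1; have t0 := gain_gt0 q q0.
have Hq : \sum_(k < K) h k * q k <=
    gain p * (\sum_(k < K) lam k * q k + mu * \sum_(k < K) g k m * q k).
  rewrite mulrDr !mulr_sumr -big_split/=; apply: ler_sum => k _.
  by have := ler_wpM2r (q0 k) (hle k); rewrite mulrDr mulrDl !mulrA.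
have Hp : \sum_(k < K) h k * p k =
    gain p * (\sum_(k < K) lam k * p k + mu * \sum_(k < K) g k m * p k).
  rewrite mulrDr !mulr_sumr -big_split/=; apply: eq_bigr => k _.
  by case: (heq k) => ->; ring.
have := lnB_le _ _ _ t0 s0.
have -> : gain q / gain p - 1 =
    (\sum_(k < K) h k * q k - \sum_(k < K) h k * p k) / gain p.
  by rewrite /gain in s0 *; field; rewrite gt_eqF.
have := ler_wpM2l mu0 (qG m); rewrite -slack => muq lnqp.
rewrite /objective -/(gain p) -/(gain q).
suff : (\sum_(k < K) h k * q k - \sum_(k < K) h k * p k) / gain p <=
  \sum_(k < K) lam k * q k - \sum_(k < K) lam k * p k by lra.
rewrite ler_pdivrMr// [leLHS](_ : _ = \sum_(k < K) h k * q k -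
    gain p * (\sum_(k < K) lam k * p k + mu * \sum_(k < K) g k m * p k)); last first.
  by rewrite -Hp.
have := ler_wpM2l (ltW s0) muq; move: Hq; lra.
Qed.

(** The hypotheses make [v] a feasible direction at [p]; if its directional derivative were
    positive, a small step along it would raise the objective. *)
Lemma optimal_first_order p v : optimal lam Gam h g p ->
  (forall k, 0 < p k \/ 0 <= v k) ->
  (forall m, \sum_(k < K) g k m * p k < Gam m \/
             \sum_(k < K) g k m * v k <= 0) ->
  \sum_(k < K) h k * v k <= gain p * \sum_(k < K) lam k * v k.
Proof.
move=> [[p0 pG] pmax] pv gv; rewrite leNgt; apply/negP => ltab.
set a := \sum_(k < K) h k * v k in ltab.
set b := \sum_(k < K) lam k * v k in ltab.
have addE (f : 'I_K -> R) e : \sum_(k < K) f k * (p k + e * v k) =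
    \sum_(k < K) f k * p k + e * \sum_(k < K) f k * v k.
  by rewrite mulr_sumr -big_split/=; apply: eq_bigr => k _; ring.
have s0 := gain_gt0 p p0.
(* The last quantity equals [a - b * gain (p + e v)]: for small [e] the slope is still positive at
   the displaced point. *)
have : \forall e \near 0^'+, [/\ 0 < e, feasible Gam g (fun k => p k + e * v k)
    & 0 < (a - gain p * b) + e * (- (a * b))].
  near=> e; split; near: e; first exact: nbhs_right_gt.
    near=> e; split; near: e; apply: filter_forall.
      by move=> k; apply: near0_addM_ge0.
    move=> m; suff : \forall e \near 0^'+, 0 <=
        (Gam m - \sum_(k < K) g k m * p k) +
        e * (- \sum_(k < K) g k m * v k).
      by apply: filterS => e; rewrite addE; lra.
    apply: near0_addM_ge0; first by rewrite subr_ge0.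
    by case: (gv m) => ?; [left; rewrite subr_gt0|right; rewrite oppr_ge0].
  by apply: near0_addM_gt0; rewrite subr_gt0.
move=> /filter_ex[e [e0 fe abe]].
have := pmax _ fe.
have t0 := gain_gt0 _ fe.1.
(* The tangent is taken at the displaced point, so that it bounds the increase of the logarithm from
   below. *)
have := lnB_le _ _ _ s0 t0.
rewrite /objective -/(gain p) /gain !addE -/a -/b addrA -/(gain p).
move: t0; rewrite /gain addE -/a addrA -/(gain p) => t0.
move=> lnpq obj.
have : 1 - gain p / (gain p + e * a) <= e * b by lra.
have -> : 1 - gain p / (gain p + e * a) = e * a / (gain p + e * a).
  by field; rewrite gt_eqF.
rewrite ler_pdivrMr// -mulrA ler_pM2l//.
by move: abe; lra.
Unshelve. all: by end_near. Qed.

(** * The argmin and conditions (a) and (b), with extended divisions removed *)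

Lemma is_argmin_ratioP i m' : is_argmin_ratio Gam g i m' <->
  forall m, Gam m' / g i m' <= Gam m / g i m.
Proof.
by split=> H m; move: (H m); rewrite !erdivE ?gt_eqF// lee_fin.
Qed.

(* The first inequality is [1 / lam - 1 / h <= Gam / g] cleared of the divisions
   by [lam], which may vanish; it forces [0 < lam i]. *)
Lemma cond_aP i m' : cond_a lam Gam h g i m' <->
  h i <= lam i * (1 + h i * (Gam m' / g i m')) /\
  forall j, j != i -> h j * lam i <= h i * lam j.
Proof.
rewrite /cond_a [erdiv 1 (h i)]erdivE ?gt_eqF// [erdiv (Gam m') _]erdivE ?gt_eqF//.
set T := Gam m' / g i m'; have := lam0 i; rewrite le_eqVlt => /predU1P[<-|li0].
  rewrite /erdiv eqxx/=; split => -[]; first by [].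
  by rewrite mul0r leNgt h0.
rewrite erdivE ?gt_eqF// -EFinB lee_fin.
have -> : (1 / lam i - 1 / h i <= T) = (h i <= lam i * (1 + h i * T)).
  rewrite -subr_ge0 -[RHS]subr_ge0.
  have -> : lam i * (1 + h i * T) - h i =
    (T - (1 / lam i - 1 / h i)) * (lam i * h i).
    by field; rewrite !gt_eqF.
  by rewrite pmulr_lge0// mulr_gt0.
split=> -[hT H]; split=> // j ji; have := H j ji.
  have := lam0 j; rewrite le_eqVlt => /predU1P[<-|lj0].
    by rewrite /erdiv eqxx (gt_eqF li0).
  rewrite !erdivE ?gt_eqF// lee_fin ler_pdivrMr// mulrAC ler_pdivlMr//.
have [lj0|lj0 Hj] := ltrP 0 (lam j).
  by rewrite !erdivE ?gt_eqF// lee_fin ler_pdivrMr// mulrAC ler_pdivlMr.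
have lj : lam j = 0 by apply/le_anti; rewrite lj0 lam0.
by move: Hj; rewrite lj mulr0 leNgt mulr_gt0.
Qed.

(** Here [g j m' / g i m'] is the exchange rate along constraint [m']: the power user [i] gives up
    per unit granted to user [j]. The second inequality says that this trade does not pay. *)
Lemma cond_bP i m' : cond_b lam Gam h g i m' <->
  lam i * (1 + h i * (Gam m' / g i m')) < h i /\
  forall j, j != i -> h j - g j m' / g i m' * h i <=
    (1 + h i * (Gam m' / g i m')) * (lam j - g j m' / g i m' * lam i).
Proof.
rewrite /cond_b [erdiv 1 (h i)]erdivE ?gt_eqF// [erdiv (Gam m') _]erdivE ?gt_eqF//.
set T := Gam m' / g i m'.
have T0 : 0 < T by rewrite divr_gt0.
have s0 : 0 < 1 + h i * T by rewrite ltr_pwDl// mulr_ge0 ?ltW.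
have -> : (T%:E < erdiv 1%R (lam i) - (1 / h i)%:E)%E =
    (lam i * (1 + h i * T) < h i).
  have := lam0 i; rewrite le_eqVlt => /predU1P[<-|li0].
    by rewrite /erdiv eqxx mul0r h0 /= ltry.
  rewrite erdivE ?gt_eqF// -EFinB lte_fin -subr_gt0 -[RHS]subr_gt0.
  have -> : h i - lam i * (1 + h i * T) =
    ((1 / lam i - 1 / h i) - T) * (lam i * h i).
    by field; rewrite !gt_eqF.
  by rewrite pmulr_lgt0// mulr_gt0.
have E j : ((h j * g i m' - h i * g j m') * (g i m' / (g i m' + h i * Gam m'))
      <= lam j * g i m' - lam i * g j m') =
   (h j - g j m' / g i m' * h i <= (1 + h i * T) * (lam j - g j m' / g i m' * lam i)).
  have d0 : 0 < g i m' + h i * Gam m' by rewrite addr_gt0// mulr_gt0.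
  rewrite -subr_ge0 -[RHS]subr_ge0.
  have -> : (1 + h i * T) * (lam j - g j m' / g i m' * lam i) -
    (h j - g j m' / g i m' * h i) =
   (lam j * g i m' - lam i * g j m' -
   (h j * g i m' - h i * g j m') * (g i m' / (g i m' + h i * Gam m'))) *
   ((g i m' + h i * Gam m') / (g i m') ^+ 2).
    by rewrite /T; field; rewrite !gt_eqF.
  by rewrite pmulr_lge0// divr_gt0// exprn_gt0.
by split=> -[? H]; split=> // j ji; have := H j ji; rewrite E.
Qed.

(** * Sufficiency: (a) and (b) produce an optimum *)

Lemma single_user_feasible i m' t : is_argmin_ratio Gam g i m' ->
  0 <= t -> t <= Gam m' / g i m' -> feasible Gam g (single_user i t).
Proof.
move=> /is_argmin_ratioP am t0 tT; split=> [k|m].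
  by rewrite /single_user; case: ifP.
by rewrite sum_single_user mulrC -ler_pdivlMr// (le_trans tT).
Qed.

Lemma cond_a_optimal i m' : is_argmin_ratio Gam g i m' ->
  cond_a lam Gam h g i m' ->
  optimal lam Gam h g (single_user i (pstar_a lam h i)).
Proof.
move=> am /cond_aP[hT hj].
have T0 : 0 < Gam m' / g i m' by rewrite divr_gt0.
have li0 : 0 < lam i.
  rewrite lt_neqAle lam0 andbT; apply/eqP => li.
  by move: hT; rewrite -li mul0r leNgt h0.
have hj' j : h j * lam i <= h i * lam j.
  by have [->|] := eqVneq j i; [rewrite mulrC|exact: hj].
have pE : h i * ((lam i)^-1 - (h i)^-1) = h i / lam i - 1.
  by field; rewrite !gt_eqF.
(* The two values of the maximum are the truncated power zero and the unconstrained optimum. *)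
have st : gain (single_user i (pstar_a lam h i)) = Num.max 1 (h i / lam i).
  rewrite /gain sum_single_user /pstar_a maxr_pMr ?ltW// mulr0 pE addr_maxr.
  by rewrite addr0 addrCA subrr addr0.
apply: (@kkt_optimal _ m' 0) => //.
- apply: single_user_feasible am _ _; first by rewrite /pstar_a le_max lexx.
  rewrite /pstar_a ge_max (ltW T0)/= -(ler_pM2l (h0 i)) pE.
  by rewrite lerBlDl ler_pdivrMr// mulrC.
- by rewrite !mul0r.
- move=> k; rewrite st mul0r addr0.
  apply: (@le_trans _ _ (h i / lam i * lam k)).
    by rewrite mulrAC ler_pdivlMr.
  by rewrite ler_wpM2r// le_max lexx orbT.
- move=> k; rewrite st mul0r addr0 /single_user.
  have [->|] := eqVneq k i; last by left.
  have [hl|hl] := leP 1 (h i / lam i); last first.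
    left; apply: max_idPl; rewrite -(ler_pM2l (h0 i)) pE mulr0; lra.
  by right; rewrite divfK ?gt_eqF.
Qed.

Lemma cond_b_optimal i m' : is_argmin_ratio Gam g i m' ->
  cond_b lam Gam h g i m' ->
  optimal lam Gam h g (single_user i (pstar_b Gam g i m')).
Proof.
move=> am /cond_bP[hT hj]; rewrite /pstar_b.
set T := Gam m' / g i m' in hT hj *; set s := 1 + h i * T in hT hj.
have T0 : 0 < T by rewrite divr_gt0.
have s0 : 0 < s by rewrite ltr_pwDl// mulr_ge0 ?ltW.
have gi0 : g i m' != 0 by rewrite gt_eqF.
have sn0 : s != 0 by rewrite gt_eqF.
have st : gain (single_user i T) = s by rewrite /gain sum_single_user.
(* The multiplier of constraint [m'], read off stationarity in [p i]. *)
pose mu := (h i / s - lam i) / g i m'.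
(* With this [mu], stationarity for [k] is the exchange inequality of [cond_bP], with equality for
   [k = i]. *)
have smu k : s * (lam k + mu * g k m') =
    s * (lam k - g k m' / g i m' * lam i) + g k m' / g i m' * h i.
  by rewrite /mu; field; apply/andP.
apply: (@kkt_optimal _ m' mu).
- exact: single_user_feasible am (ltW T0) _.
- by rewrite divr_ge0 ?(ltW (g0 _ _))// subr_ge0 ler_pdivlMr// ltW.
- by rewrite sum_single_user /T [_ * (Gam m' / _)]mulrC divfK.
- move=> k; rewrite st smu; have [->|ki] := eqVneq k i.
    by rewrite divff// !mul1r subrr mulr0 add0r.
  by have := hj _ ki; lra.
- move=> k; rewrite st smu /single_user; have [->|] := eqVneq k i; last by left.
  by right; rewrite divff// !mul1r subrr mulr0 add0r.
Qed.

(** * Necessity: a single-user optimum satisfies (a) or (b) *)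

Hypothesis M0 : (0 < M)%N.
(** Cross-multiplied form of distinct ratios [Gam m / g i m]: the argmin is unique, so a single user
    can meet at most one constraint with equality. *)
Hypothesis noties : forall i m m', m != m' -> Gam m * g i m' != Gam m' * g i m.

Lemma exists_argmin_ratio i : exists m', is_argmin_ratio Gam g i m'.
Proof.
have [m' _ Hm] := @arg_minP _ _ _ (Ordinal M0) predT (fun m => Gam m / g i m) isT.
by exists m'; apply/is_argmin_ratioP => m; exact: Hm.
Qed.

(** Switching on any user [k] alone must not pay, so [h k <= lam k]. All [lam k] are then positive,
    and a user maximizing [h k / lam k] satisfies (a); [i] shows that there is a user at all. *)
Lemma zero_optimal_cond_a (i : 'I_K) : optimal lam Gam h g (fun=> 0) ->
  exists i m', is_argmin_ratio Gam g i m' /\ cond_a lam Gam h g i m'.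
Proof.
move=> opt.
have sum0 (f : 'I_K -> R) : \sum_(k < K) f k * 0 = 0.
  by rewrite big1// => k _; rewrite mulr0.
have hl k : h k <= lam k.
  have := optimal_first_order (fun=> 0) (single_user k 1) opt.
  rewrite /gain sum0 !sum_single_user !mulr1 addr0 mul1r; apply.
    by move=> j; right; rewrite /single_user; case: ifP.
  by move=> m; left; rewrite sum0.
have l0 k : 0 < lam k by exact: lt_le_trans (hl k).
have [i' _ Hi] := @arg_maxP _ _ _ i predT (fun k => h k / lam k) isT.
have [m' am] := exists_argmin_ratio i'.
exists i', m'; split=> //; apply/cond_aP; split=> [|j _].
  rewrite (le_trans (hl i'))// mulrDr mulr1 lerDl.
  by rewrite !mulr_ge0 ?divr_ge0 ?invr_ge0 ?ltW.
have : h j / lam j <= h i' / lam i' by exact: Hi.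
by rewrite ler_pdivrMr// mulrAC ler_pdivlMr//.
Qed.

Lemma single_user_optimal_cond i t : 0 < t ->
  optimal lam Gam h g (single_user i t) ->
  exists m', is_argmin_ratio Gam g i m' /\
    (cond_a lam Gam h g i m' \/ cond_b lam Gam h g i m').
Proof.
move=> t0 opt; have [m' am] := exists_argmin_ratio i; exists m'; split=> //.
set T := Gam m' / g i m'.
have gtG m : g i m * t <= Gam m.
  by have := opt.1.2 m; rewrite sum_single_user.
have tT : t <= T by rewrite ler_pdivlMr// mulrC.
have slackm m : m != m' \/ t < T -> g i m * t < Gam m.
  move=> H; rewrite mulrC -ltr_pdivlMr//.
  have /is_argmin_ratioP/(_ m) := am; rewrite -/T.
  case: H => [mm'|tT']; last exact: lt_le_trans.
  rewrite le_eqVlt => /predU1P[/esym/eqP|]; last exact: le_lt_trans.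
  have gn0 k : g i k != 0 by rewrite gt_eqF.
  by rewrite eqr_div// (negbTE (noties i _ _ mm')).
(* Directions changing only the powers of users [j] (by [a]) and [i] (by [b]). *)
pose v a b j k := single_user j a k + single_user i b k : R.
have sumv (f : 'I_K -> R) a b j :
    \sum_(k < K) f k * v a b j k = f j * a + f i * b.
  by under eq_bigr do rewrite mulrDr; rewrite big_split/= !sum_single_user.
have fo a b j : 0 <= a ->
    (forall m, g i m * t < Gam m \/ g j m * a + g i m * b <= 0) ->
    h j * a + h i * b <= (1 + h i * t) * (lam j * a + lam i * b).
  move=> a0 H; have := optimal_first_order _ (v a b j) opt.
  rewrite /gain !sumv sum_single_user; apply.
    move=> k; rewrite /v /single_user; have [ki|ki] := eqVneq k i.
      by left.
    by right; rewrite addr0; case: ifP.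
  by move=> m; rewrite sumv sum_single_user.
(* Lowering the power of user [i] is always feasible, as [t] is positive. *)
have Hi : lam i * (1 + h i * t) <= h i.
  have := fo 0 (-1) i (lexx _); rewrite !mulr0 !add0r !mulrN1.
  rewrite mulrN lerN2 mulrC; apply=> m; right.
  by rewrite !mulr0 add0r mulrN1 oppr_le0 ltW.
(* Below [T] every constraint is slack: user [i] may also be raised, which gives equality, and any
   [j] may be switched on alone. *)
have [tltT|] := ltrP t T.
  have slk m : g i m * t < Gam m by apply: slackm; right.
  have Hi' : h i <= lam i * (1 + h i * t).
    have := fo 0 1 i (lexx _); rewrite !mulr0 !add0r !mulr1 mulrC.
    by apply=> m; left.
  left; apply/cond_aP; split=> [|j ji].
    by rewrite (le_trans Hi')// ler_wpM2l// lerD2l ler_pM2l.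
  have := fo 1 0 j ler01; rewrite !mulr0 !mulr1 !addr0 => Hj.
  have -> : h i = lam i * (1 + h i * t) by apply/le_anti; rewrite Hi Hi'.
  rewrite mulrC -mulrA ler_wpM2l//; apply: Hj => m.
  by left.
move=> Tt; have {t0 gtG slackm fo Hi opt tT Tt} [fo Hi] : 
   (forall j, h j - g j m' / g i m' * h i <=
    (1 + h i * T) * (lam j - g j m' / g i m' * lam i)) /\
   lam i * (1 + h i * T) <= h i.
  have tE : t = T by apply/le_anti; rewrite tT Tt.
  split; last by rewrite -tE.
  (* This direction keeps the load on the tight constraint [m'] unchanged; all other constraints are
     slack. *)
  move=> j; have := fo 1 (- (g j m' / g i m')) j ler01.
  rewrite !mulr1 !mulrN ![_ * (g j m' / _)]mulrC -tE; apply => m.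
  have [->|mm'] := eqVneq m m'; last by left; apply: slackm; left.
  by right; rewrite mulrN mulr1 mulrC divfK ?gt_eqF// subrr.
(* Equality means a vanishing multiplier: the exchange terms cancel and (a) results, whereas (b)
   needs strictness. *)
move: Hi; rewrite le_eqVlt => /predU1P[hE|hT]; last first.
  by right; apply/cond_bP; split=> // j _; exact: fo.
left; apply/cond_aP; split=> [|j _]; first by rewrite -/T hE.
have : h j <= (1 + h i * T) * lam j 
  by have := fo j; have := congr1 ( *%R (g j m' / g i m')) hE; lra.
move=> hj; rewrite -[X in X * lam j]hE.
by rewrite [leLHS]mulrC -mulrA ler_wpM2l.
Qed.

Lemma single_user_optimal_iff :
  (exists p, optimal lam Gam h g p /\ exists i, forall j, j != i -> p j = 0) <->
  exists i m', is_argmin_ratio Gam g i m' /\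
    (cond_a lam Gam h g i m' \/ cond_b lam Gam h g i m').
Proof.
split=> [[p [opt [i pi]]]|[i [m' [am []]]] H]; last first.
- exists (single_user i (pstar_b Gam g i m')); split.
    exact: cond_b_optimal.
  by exists i => j /negbTE ji; rewrite /single_user ji.
- exists (single_user i (pstar_a lam h i)); split.
    exact: (cond_a_optimal i m').
  by exists i => j /negbTE ji; rewrite /single_user ji.
have pE : p = single_user i (p i).
  by apply/funext => k; rewrite /single_user; case: eqVneq => [->//|/pi].
(* If [p i = 0], the given user is arbitrary and need not satisfy (a), so another one is found. *)
have := opt.1.1 i; rewrite le_eqVlt => /predU1P[pi0|pi0]; last first.
  by rewrite pE in opt; exists i; exact: single_user_optimal_cond opt.
have p0 : p = fun=> 0.
  by rewrite pE -pi0; apply/funext => k; rewrite /single_user; case: ifP.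
rewrite p0 in opt.
have [i' [m' [am ca]]] := zero_optimal_cond_a i opt.
by exists i', m'; split=> //; left.
Qed.

End Deterministic.

(** * Null sets: atomless marginals and ties *)

Section AlmostSure.
Context (R : realType) (d : measure_display) (Omega : measurableType d).
Context (P : probability Omega R).

(** A CDF only measures orthants with finite corners, so the hyperplane is covered by countably many
    pieces on which the other coordinates are at most [n]. *)
Lemma cdf_atomless (N : nat) (alpha : Omega -> 'rV[R]_N) :
  (forall j, measurable_fun setT (fun w => alpha w 0 j)) ->
  continuous (joint_cdf P alpha) ->
  forall j c, P ((fun w => alpha w 0 j) @^-1` [set c]) = 0%E.
Proof.
move=> ma cF j c.
have mle (x : 'rV[R]_N) : measurable [set w | forall k, alpha w 0 k <= x 0 k].
  rewrite [X in measurable X](_ : _ = \bigcap_(k in setT)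
      ((fun w => alpha w 0 k) @^-1` `]-oo, x 0 k])); last first.
    apply/seteqP; split=> w /= H k; first by move=> _; rewrite /= in_itv/=.
    by have := H k I; rewrite /= in_itv/=.
  apply: fin_bigcap_measurable => // k _.
  by rewrite -[X in measurable X]setTI; exact: ma.
have mc : measurable ((fun w => alpha w 0 j) @^-1` [set c]).
  by rewrite -[X in measurable X]setTI; exact: ma.
apply: (measure_negligible mc).
pose x (n : nat) (e : R) : 'rV[R]_N := \row_k (if k == j then c + e else n%:R).
(* The hyperplane piece [A n] sits in the gap between the orthants with corners
   [x n (- e)] and [x n 0], whose probability tends to 0 with [e]. *)
pose A n := [set w | alpha w 0 j = c /\ forall k, k != j -> alpha w 0 k <= n%:R].
apply: (@negligibleS _ _ _ P (\bigcup_n A n)).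
  move=> w /= wc.
  have : \forall n \near \oo, forall k, alpha w 0 k <= n%:R.
    apply: filter_forall => k; exact: nbhs_infty_ger.
  by move=> /filter_ex[n Hn]; exists n => //; split.
apply: negligible_bigcup => n.
have AE : A n = [set w | forall k, alpha w 0 k <= x n 0 0 k] `&`
   (fun w => alpha w 0 j) @^-1` [set c].
  apply/seteqP; split => w /=.
    move=> [wc H]; split=> // k; rewrite mxE addr0.
    by case: eqVneq => [->|/H//]; rewrite wc.
  move=> [H wc]; split=> // k kj; have := H k.
  by rewrite mxE (negbTE kj).
have mA : measurable (A n) by rewrite AE; exact: measurableI.
apply/negligibleP => //.
have le_gap e : 0 < e ->
    fine (P (A n)) <= joint_cdf P alpha (x n 0) - joint_cdf P alpha (x n (- e)).
  move=> e0; rewrite lerBrDr /joint_cdf -fineD ?fin_num_measure//.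
  rewrite -measureU//; last first.
    apply/seteqP; split => // w [] [wc _] /= /(_ j).
    rewrite wc mxE eqxx; lra.
  apply: fine_le; rewrite ?fin_num_measure//; first exact: measurableU.
  apply: le_measure; rewrite ?inE//; first exact: measurableU.
  rewrite AE subUset; split; first by move=> w [].
  move=> w /= H k; apply: (le_trans (H k)); rewrite !mxE; case: ifP => // _; lra.
have cx : x n (- e) @[e --> 0^'+] --> x n 0.
  apply/cvg_ballP => r r0; near=> e; split=> // k l; rewrite !mxE.
  case: ifP => _; last exact: ballxx.
  have e0 : 0 < e by near: e; exact: nbhs_right_gt.
  rewrite /ball/= [X in `|X|](_ : _ = e); last by lra.
  by rewrite gtr0_norm//; near: e; exact: nbhs_right_lt.
have cgap : joint_cdf P alpha (x n 0) - joint_cdf P alpha (x n (- e))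
    @[e --> 0^'+] --> 0.
  have := cvgB (cvg_cst (joint_cdf P alpha (x n 0))) (cvg_comp _ _ cx (cF _)).
  by rewrite addrN; apply.
have : fine (P (A n)) <= 0.
  apply: (closed_cvg (fun y => fine (P (A n)) <= y) _ _ _ cgap) => //.
  by near=> e; apply: le_gap; near: e; exact: nbhs_right_gt.
move=> Ple; apply/eqP; rewrite eq_le measure_ge0 andbT.
by rewrite -(fineK (fin_num_measure P _ mA)) lee_fin.
Unshelve. all: by end_near. Qed.

Lemma mutually_independent_pair (J : finType) (X : J -> Omega -> R) :
  (forall i, measurable_fun setT (X i)) -> mutually_independent P X ->
  forall i j (A B : set R), i != j -> measurable A -> measurable B ->
  P (X i @^-1` A `&` X j @^-1` B) = (P (X i @^-1` A) * P (X j @^-1` B))%E.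
Proof.
move=> mX indX i j A B ij mA mB.
have mpre k C : measurable C -> measurable (X k @^-1` C).
  by move=> mC; rewrite -[X in measurable X]setTI; exact: mX.
pose C k := if k == i then A else if k == j then B else setT.
have mC k : measurable (C k) by rewrite /C; do 2 case: ifP => //.
have := indX C mC.
have -> : \bigcap_(k in setT) (X k @^-1` C k) = X i @^-1` A `&` X j @^-1` B.
  apply/seteqP; split=> w /=.
    move=> H; have := H i I; have := H j I.
    by rewrite /C /= eqxx (eq_sym j) (negbTE ij) eqxx.
  move=> [Ai Bj] k _; rewrite /C/=.
  by case: eqVneq => [->//|_]; case: eqVneq => [->|].
rewrite (bigD1 i)//= (bigD1 j)/=; last by rewrite eq_sym.
rewrite big1 => [|k /andP[ki kj]]; last first.
  by rewrite /C (negbTE ki) (negbTE kj) preimage_setT probability_setT.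
rewrite mulr1 {1 2}/C eqxx (eq_sym j) (negbTE ij) eqxx => E.
rewrite -[LHS]fineK ?fin_num_measure//; last by apply: measurableI; exact: mpre.
by rewrite E EFinM !fineK// fin_num_measure//; exact: mpre.
Qed.

(** By independence the joint law is the product of the marginals; since [b != 0], each section of
    the tie line is one point, which is null for [Y]. *)
Lemma independent_tie (X Y : Omega -> R) (a b : R) :
  measurable_fun setT X -> measurable_fun setT Y ->
  (forall A B, measurable A -> measurable B ->
    P (X @^-1` A `&` Y @^-1` B) = (P (X @^-1` A) * P (Y @^-1` B))%E) ->
  (forall c, P (Y @^-1` [set c]) = 0%E) -> b != 0 ->
  P.-negligible [set w | a * X w = b * Y w].
Proof.
move=> mX mY ind Y0 b0.
have mXY : measurable_fun setT (fun w => (X w, Y w)).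
  exact: measurable_fun_pair.
pose D := [set xy : R * R | a * xy.1 = b * xy.2].
have mD : measurable D.
  have -> : D = (fun xy : R * R => a * xy.1 - b * xy.2) @^-1` [set 0].
    apply/seteqP; split => xy /=; rewrite /D/=; first by move=> ->; rewrite subrr.
    by move/eqP; rewrite subr_eq0 => /eqP.
  rewrite -[X in measurable X]setTI.
  suff : measurable_fun setT (fun xy : R * R => a * xy.1 - b * xy.2) by apply.
  by apply: measurable_funB; apply: measurable_funM.
apply/negligibleP.
  rewrite [X in measurable X](_ : _ = (fun w => (X w, Y w)) @^-1` D)//.
  by rewrite -[X in measurable X]setTI; exact: mXY.
pose X' : {RV P >-> R} := mfun_Sub (mem_set mX).
pose Y' : {RV P >-> R} := mfun_Sub (mem_set mY).
pose XY' : {RV P >-> (R * R)%type} := mfun_Sub (mem_set mXY).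
(* The product rule on rectangles, [ind], identifies the joint law with the product measure. *)
have XYE := @product_measure_unique _ _ _ _ _
  (distribution P X') (distribution P Y') (distribution P XY') ind D mD.
rewrite -[LHS]/(distribution P XY' D) -XYE.
rewrite /product_measure1; apply: integral0_eq => x _ /=.
rewrite xsectionE (_ : _ @^-1` D = [set b^-1 * (a * x)]); last first.
  apply/seteqP; split => y; rewrite /D/=; last by move=> ->; rewrite mulVKf.
  by move=> ->; rewrite mulKf.
exact: Y0.
Qed.
End AlmostSure.

(** * Passage to almost every realization *)

Theorem theorem3p2 (R : realType) (d : measure_display) (Omega : measurableType d)
  (P : probability Omega R) (K M : nat)
  (alpha : Omega -> 'rV[R]_(K + K * M))
  (lam : 'I_K -> R) (Gam : 'I_M -> R) :
  (0 < M)%N ->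
  (forall k, 0 <= lam k) ->
  (forall m, 0 < Gam m) ->
  (forall j, measurable_fun setT (fun w => alpha w 0 j)) ->
  (forall w j, 0 <= alpha w 0 j) ->
  mutually_independent P (fun j w => alpha w 0 j) ->
  continuous (joint_cdf P alpha) ->
  (forall x, differentiable (joint_cdf P alpha) x) ->
  {ae P, forall w,
    let h := hgain (alpha w) in
    let g := ggain (alpha w) in
    ((exists p, optimal lam Gam h g p /\
                exists i, forall j, j != i -> p j = 0)
     <->
     exists i m', is_argmin_ratio Gam g i m' /\
                  (cond_a lam Gam h g i m' \/ cond_b lam Gam h g i m'))
    /\
    (forall i m', is_argmin_ratio Gam g i m' ->
       (cond_a lam Gam h g i m' ->
          optimal lam Gam h g (single_user i (pstar_a lam h i))) /\
       (cond_b lam Gam h g i m' ->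
          optimal lam Gam h g (single_user i (pstar_b Gam g i m'))))}.
Proof.
move=> M0 lam0 Gam0 ma a0 ind cF _.
have atomless := cdf_atomless _ _ _ P _ alpha ma cF.
have pos : \forall w \ae P, forall j, 0 < alpha w 0 j.
  apply: filter_forall => j.
  apply: (negligibleS _
    (_ : P.-negligible ((fun w => alpha w 0 j) @^-1` [set 0]))).
    move=> w /= /negP; rewrite -leNgt => le0.
    by apply/le_anti; rewrite le0 a0.
  apply/negligibleP; last exact: atomless.
  by rewrite -[X in measurable X]setTI; exact: ma.
have noties : \forall w \ae P, forall i m m', m != m' ->
    Gam m * ggain (alpha w) i m' != Gam m' * ggain (alpha w) i m.
  apply: filter_forall => i; apply: filter_forall => m; apply: filter_forall => m'.
  have [->|mm'] := eqVneq m m'; first exact: aeW.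
  pose j k := rshift K (mxvec_index i k) : 'I_(K + K * M).
  (* Distinct constraints index distinct coordinates of [alpha], so pairwise independence applies to
     the two gains. *)
  have jj' : j m' != j m.
    rewrite (inj_eq (@rshift_inj _ _)); apply: contra mm' => /eqP jE.
    have [f fK _] := curry_mxvec_bij K M.
    by have := congr1 f jE; rewrite (fK (i, m') isT) (fK (i, m) isT) => -[->].
  have tie : P.-negligible
      [set w | Gam m * alpha w 0 (j m') = Gam m' * alpha w 0 (j m)].
    apply: independent_tie => //; last by rewrite gt_eqF.
    by move=> A B; apply: (mutually_independent_pair _ _ _ P _ _ ma ind).
  apply: negligibleS tie => w /= ntie.
  by apply: contrapT => /eqP ne; exact: ntie.
move: pos noties; apply: filterS2 => w h0 nt.
set h := hgain (alpha w); set g := ggain (alpha w).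
have hp k : 0 < h k by exact: h0.
have gp k m : 0 < g k m by exact: h0.
split; first exact: single_user_optimal_iff.
move=> i m' am; split.
  exact: cond_a_optimal.
exact: cond_b_optimal.
Qed.
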